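(* Let $n\geq 2$ and $X=\mathbb{R}^n$. Let $\mathcal{L}\cap\mathcal{S}$ be the set of all maximally monotone operators $A\colon X\rightrightarrows X$ whose graph is a linear subspace of $X\times X$ and which are of the form $A=\partial f$ for some $f\in\Gamma_0(X)$. Equip $(\mathcal{L}\cap\mathcal{S})^2=(\mathcal{L}\cap\mathcal{S})\times(\mathcal{L}\cap\mathcal{S})$ with the metric $$\big((A_1,B_1),(A_2,B_2)\big)\mapsto \|J_{A_1}-J_{A_2}\|+\|J_{B_1}-J_{B_2}\|.$$ For $(A,B)\in(\mathcal{L}\cap\mathcal{S})^2$ let $T_{(A,B)}=\tfrac12(\mathrm{Id}+R_BR_A)$ be the Douglas--Rachford operator. Then the set $$D:=\{(A,B)\in(\mathcal{L}\cap\mathcal{S})^2 \mid T_{(A,B)}\text{ is a proximal mapping}\}$$ is a closed subset of $(\mathcal{L}\cap\mathcal{S})^2$ that is nowhere dense in $(\mathcal{L}\cap\mathcal{S})^2$. (In this sense, generically, the Douglas--Rachford operators for symmetric linear relations are not proximal mappings.)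
   Context: $X=\mathbb{R}^n$ carries the standard inner product $\langle\cdot,\cdot\rangle$ and Euclidean norm. A set-valued operator $A\colon X\rightrightarrows X$ is monotone if $\langle x-y,x^*-y^*\rangle\geq 0$ for all $(x,x^* ),(y,y^* )$ in its graph, and maximally monotone if no proper enlargement of its graph is monotone. $\Gamma_0(X)$ is the set of convex, lower semicontinuous, proper functions from $X$ to $]-\infty,+\infty]$, and $\partial f$ denotes the (convex) subdifferential operator of $f$. $\mathcal{L}$ denotes the set of maximally monotone operators on $X$ that are linear relations, i.e., whose graph is a linear subspace of $X\times X$; $\mathcal{S}$ denotes the set of subdifferential operators $\partial f$ with $f\in\Gamma_0(X)$. For a maximally monotone $A$, $J_A=(\mathrm{Id}+A)^{-1}$ is the resolvent (single-valued with full domain) and $R_A=2J_A-\mathrm{Id}$ is the reflected resolvent; when $A\in\mathcal{L}$, both are linear maps, identified with $n\times n$ matrices, and $\|\cdot\|$ on matrices is the operator norm $\|R\|=\sup_{\|x\|\leq1}\|Rx\|$. A map $T\colon X\to X$ is a proximal mapping if $T=J_{\partial h}=(\mathrm{Id}+\partial h)^{-1}$ for some $h\in\Gamma_0(X)$. *)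

(* Defs.v *)
From HB Require Import structures.
From mathcomp Require Import all_boot all_order all_algebra.
From mathcomp Require Import all_classical all_reals all_analysis.
From mathcomp Require Import ring lra.

Set Implicit Arguments.
Unset Strict Implicit.
Unset Printing Implicit Defensive.

Import Order.TTheory GRing.Theory Num.Theory.
Import numFieldNormedType.Exports.

Local Open Scope classical_set_scope.
Local Open Scope ring_scope.

Section Euclidean.
Context {R : realType} {n : nat}.
Local Notation X := 'cV[R]_n.
Implicit Types (x y z : X) (f g : X -> X).

Definition dot x y : R := \sum_(i < n) x i 0 * y i 0.

(* The library norm of 'cV[R]_n is the sup norm, so the Euclidean norm is
   defined here; both induce the same topology. *)
Definition enorm x : R := Num.sqrt (dot x x).

(* Meaningful when f is bounded on the unit ball, in particular for linear f;
   the real-valued sup of an unbounded set is 0. *)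
Definition opnorm f : R := sup [set enorm (f x) | x in [set x | enorm x <= 1]].

Lemma dotC x y : dot x y = dot y x.
Proof. by apply: eq_bigr => i _; rewrite mulrC. Qed.

Lemma dotDl x y z : dot (x + y) z = dot x z + dot y z.
Proof. by rewrite /dot -big_split; apply: eq_bigr => i _; rewrite !mxE mulrDl. Qed.

Lemma dotZl a x y : dot (a *: x) y = a * dot x y.
Proof. by rewrite /dot mulr_sumr; apply: eq_bigr => i _; rewrite !mxE mulrA. Qed.

Lemma dotNl x y : dot (- x) y = - dot x y.
Proof. by rewrite -scaleN1r dotZl mulN1r. Qed.

Lemma dotDr x y z : dot x (y + z) = dot x y + dot x z.
Proof. by rewrite dotC dotDl !(dotC x). Qed.

Lemma dotZr a x y : dot x (a *: y) = a * dot x y.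
Proof. by rewrite dotC dotZl dotC. Qed.

Lemma dotNr x y : dot x (- y) = - dot x y.
Proof. by rewrite dotC dotNl dotC. Qed.

Lemma dot0l x : dot 0 x = 0.
Proof. by rewrite -(scale0r 0) dotZl mul0r. Qed.

Lemma dotxx_ge0 x : 0 <= dot x x.
Proof. by apply: sumr_ge0 => i _; rewrite -expr2 sqr_ge0. Qed.

Lemma dotxx_eq0 x : dot x x = 0 -> x = 0.
Proof.
move/eqP; rewrite psumr_eq0 => [/allP x0|i _]; last by rewrite -expr2 sqr_ge0.
apply/colP => i; rewrite mxE; have := x0 i (mem_index_enum i).
by rewrite -expr2 sqrf_eq0 => /eqP.
Qed.

Lemma enorm_ge0 x : 0 <= enorm x.
Proof. exact: sqrtr_ge0. Qed.

Lemma enorm_sqr x : enorm x ^+ 2 = dot x x.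
Proof. by rewrite sqr_sqrtr// dotxx_ge0. Qed.

Lemma enorm0 : enorm 0 = 0.
Proof. by rewrite /enorm dot0l sqrtr0. Qed.

Lemma enorm0_eq0 x : enorm x = 0 -> x = 0.
Proof. by move=> x0; apply: dotxx_eq0; rewrite -enorm_sqr x0 expr0n. Qed.

Lemma enormN x : enorm (- x) = enorm x.
Proof. by rewrite /enorm dotNl dotNr opprK. Qed.

Lemma enormZ a x : enorm (a *: x) = `|a| * enorm x.
Proof. by rewrite /enorm dotZl dotZr mulrA -expr2 sqrtrM ?sqr_ge0// sqrtr_sqr. Qed.

Lemma cauchy_schwarz x y : dot x y <= enorm x * enorm y.
Proof.
have [/enorm0_eq0->|x0] := eqVneq (enorm x) 0; first by rewrite dot0l enorm0 mul0r.
have [/enorm0_eq0->|y0] := eqVneq (enorm y) 0.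
  by rewrite dotC dot0l enorm0 mulr0.
have xy : 0 < enorm x * enorm y.
  by rewrite mulr_gt0// lt_neqAle eq_sym enorm_ge0 ?x0 ?y0.
have := dotxx_ge0 (enorm y *: x - enorm x *: y).
rewrite !(dotDl, dotDr, dotNl, dotNr, dotZl, dotZr) -!enorm_sqr (dotC y x).
move: (enorm x) (enorm y) (dot x y) xy => a b c ab h.
have {}h : 0 <= (a * b) * (a * b - c) by nra.
by rewrite -subr_ge0 -(pmulr_rge0 _ ab).
Qed.

Lemma enormD x y : enorm (x + y) <= enorm x + enorm y.
Proof.
rewrite -(@ler_pXn2r _ 2)// ?nnegrE ?addr_ge0 ?enorm_ge0//.
rewrite enorm_sqr !(dotDl, dotDr) sqrrD !enorm_sqr (dotC y x).
by have := cauchy_schwarz x y; lra.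
Qed.

End Euclidean.

Section Operators.
Context {R : realType} {n : nat}.
Local Notation X := 'cV[R]_n.
Implicit Types (A B : X -> set X) (f : X -> \bar R) (T : X -> X) (x y : X).

Definition graph A : set (X * X) := [set p | A p.1 p.2].

Definition monotone_op A : Prop :=
  forall x x' y y', A x x' -> A y y' -> 0 <= dot (x - y) (x' - y').

Definition maximally_monotone A : Prop :=
  monotone_op A /\
  forall B, monotone_op B -> graph A `<=` graph B -> graph B = graph A.

Definition linear_relation A : Prop := submod_closed [in graph A].

(* f is valued in ]-oo, +oo] and not identically +oo. *)
Definition proper_fun f : Prop :=
  (forall x, f x != -oo%E) /\ exists x, (f x < +oo)%E.

Definition convex_fun f : Prop :=
  forall x y (t : R), 0 < t < 1 ->
    (f (t *: x + (1 - t) *: y)%R <= t%:E * f x + (1 - t)%R%:E * f y)%E.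

Definition Gamma0 : set (X -> \bar R) :=
  [set f | [/\ convex_fun f, lower_semicontinuous f & proper_fun f]].

Definition subdiff f : X -> set X :=
  fun x => [set u | forall y, ((dot (y - x)%R u)%:E + f x <= f y)%E].

Definition Id_add A : X -> set X := fun x => [set x + u | u in A x].

Definition inverse_op A : X -> set X := fun y => [set x | A x y].

(* (Id + A)^-1 y is a singleton for every y when A is maximally monotone; the
   default value 0 is a convention that is only used for other operators. *)
Definition resolvent A : X -> X := fun y => xget 0 (inverse_op (Id_add A) y).

Definition reflected_resolvent A : X -> X := fun x => 2 *: resolvent A x - x.

Definition Douglas_Rachford A B : X -> X :=
  fun x => 2^-1 *: (x + reflected_resolvent B (reflected_resolvent A x)).

Definition proximal_mapping T : Prop :=
  exists2 h, Gamma0 h & T = resolvent (subdiff h).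

Definition max_monotone_linear : set (X -> set X) :=
  [set A | maximally_monotone A /\ linear_relation A].

Definition subdifferentials : set (X -> set X) := [set subdiff f | f in Gamma0].

End Operators.
Arguments max_monotone_linear : clear implicits.
Arguments subdifferentials : clear implicits.

Definition symmetric_linear (R : realType) (n : nat) : Type :=
  set_type (max_monotone_linear R n `&` subdifferentials R n).

Definition symmetric_linear_op {R : realType} {n : nat}
  (A : symmetric_linear R n) : 'cV[R]_n -> set 'cV[R]_n := val A.
Coercion symmetric_linear_op : symmetric_linear >-> Funclass.

(* A separate name, so that the metric below (a sum) is not confused with the
   product structure of the library (a maximum). *)
Definition symmetric_linear_pair (R : realType) (n : nat) : Type :=
  (symmetric_linear R n * symmetric_linear R n)%type.

HB.instance Definition _ (R : realType) (n : nat) :=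
  gen_eqMixin (symmetric_linear_pair R n).
HB.instance Definition _ (R : realType) (n : nat) :=
  gen_choiceMixin (symmetric_linear_pair R n).

Definition resolvent_dist {R : realType} {n : nat}
    (A B : 'cV[R]_n -> set 'cV[R]_n) : R :=
  opnorm (fun x => resolvent A x - resolvent B x).

Section PairMetric.
Context {R : realType} {n : nat}.
Local Notation X := 'cV[R]_n.
Local Notation LS := (symmetric_linear R n).
Local Notation LS2 := (symmetric_linear_pair R n).
Implicit Types (A B C : LS) (p q r : LS2).

Definition pair_dist p q : R := resolvent_dist p.1 q.1 + resolvent_dist p.2 q.2.

Lemma LS_maxmon A : maximally_monotone A.
Proof. by have /set_mem[[]] := valP A. Qed.

Lemma LS_0 A : A 0 0.
Proof. by have /set_mem[[_ []]] := valP A; rewrite inE. Qed.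

Lemma LS_lin A a x x' y y' : A x x' -> A y y' -> A (a *: x + y) (a *: x' + y').
Proof.
have /set_mem[[_ [_ lA]] _] := valP A; move=> Ax Ay.
have := lA a (x, x') (y, y'); rewrite !inE => h.
exact: (h Ax Ay).
Qed.

Lemma resolvent_or A x :
  A (resolvent A x) (x - resolvent A x) \/
  resolvent A x = 0 /\ forall y, ~ A y (x - y).
Proof.
rewrite /resolvent; case: xgetP => [y _ [u Au <-]|nA].
  by left; rewrite addrC addKr.
right; split => // y Ay; apply: (nA y); exists (x - y) => //.
by rewrite addrC subrK.
Qed.

Lemma resolvent_graph A x u : A x u -> resolvent A (x + u) = x.
Proof.
move=> Axu; have [Ay|[_ /(_ x)]] := resolvent_or A (x + u); last first.
  by rewrite (addrC x) addrK.
set y := resolvent _ _ in Ay *; have := (LS_maxmon A).1 _ _ _ _ Axu Ay.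
have -> : u - (x + u - y) = - (x - y) by apply/colP => i; rewrite !mxE; ring.
rewrite dotNr oppr_ge0 => xy; apply/esym/eqP; rewrite -subr_eq0; apply/eqP.
by apply: dotxx_eq0; apply/eqP; rewrite eq_le xy dotxx_ge0.
Qed.

Lemma enorm_resolvent A x : enorm (resolvent A x) <= enorm x.
Proof.
have [Ay|[-> _]] := resolvent_or A x; last by rewrite enorm0 enorm_ge0.
set y := resolvent A x in Ay *.
have := (LS_maxmon A).1 _ _ _ _ Ay (LS_0 A).
rewrite !subr0 dotDr dotNr subr_ge0 -enorm_sqr => yx.
have [->|y0] := eqVneq (enorm y) 0; first exact: enorm_ge0.
have {}y0 : 0 < enorm y by rewrite lt_neqAle eq_sym y0 enorm_ge0.
by rewrite -(ler_pM2l y0) -expr2 (le_trans yx)// cauchy_schwarz.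
Qed.

Lemma resolvent_dist_ub A B x :
  enorm x <= 1 -> enorm (resolvent A x - resolvent B x) <= resolvent_dist A B.
Proof.
move=> x1; apply: ub_le_sup; last by exists x.
exists 2 => _ [y y1 <-]; rewrite (le_trans (enormD _ _))// enormN.
have := enorm_resolvent A y; have := enorm_resolvent B y; rewrite /= in y1.
by lra.
Qed.

Lemma resolvent_dist_le A B e :
  (forall x, enorm x <= 1 -> enorm (resolvent A x - resolvent B x) <= e) ->
  resolvent_dist A B <= e.
Proof.
move=> ABe; apply: ge_sup; last by move=> _ [x x1 <-]; exact: ABe.
by exists (enorm (resolvent A 0 - resolvent B 0)), 0 => //=; rewrite enorm0.
Qed.

Lemma resolvent_dist_ge0 A B : 0 <= resolvent_dist A B.
Proof.
by apply: le_trans (enorm_ge0 _) (resolvent_dist_ub _ _ (x := 0) _); rewrite enorm0.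
Qed.

Lemma resolvent_distxx A : resolvent_dist A A = 0.
Proof.
apply/eqP; rewrite eq_le resolvent_dist_ge0 andbT.
by apply: resolvent_dist_le => x _; rewrite subrr enorm0.
Qed.

Lemma resolvent_dist_sym A B : resolvent_dist A B = resolvent_dist B A.
Proof.
by apply/le_anti/andP; split; apply: resolvent_dist_le => x x1;
  rewrite -enormN opprB resolvent_dist_ub.
Qed.

Lemma resolvent_dist_triangle B A C :
  resolvent_dist A C <= resolvent_dist A B + resolvent_dist B C.
Proof.
apply: resolvent_dist_le => x x1.
rewrite -(subrKA (resolvent B x)) (le_trans (enormD _ _))//.
by rewrite lerD ?resolvent_dist_ub.
Qed.

Lemma LS_Z A a x u : A x u -> A (a *: x) (a *: u).
Proof. by move=> Axu; have := LS_lin a Axu (LS_0 A); rewrite !addr0. Qed.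

Lemma LS_D A x u y v : A x u -> A y v -> A (x + y) (u + v).
Proof. by move=> Axu Ayv; have := LS_lin 1 Axu Ayv; rewrite !scale1r. Qed.

Lemma LS_sub A x u y v : A x u -> A y v -> A (x - y) (u - v).
Proof.
move=> Axu /(LS_Z (-1)); rewrite !scaleN1r; exact: LS_D.
Qed.

Lemma resolventZ A a x : resolvent A (a *: x) = a *: resolvent A x.
Proof.
have [->|a0] := eqVneq a 0.
  by rewrite !scale0r -[X in resolvent _ X](addr0 0) (resolvent_graph (LS_0 A)).
have [Ay|[-> nA]] := resolvent_or A x.
  have := resolvent_graph (LS_Z a Ay).
  by rewrite -scalerDr (addrC _ (x - _)) subrK.
have [Ay|[-> _]] := resolvent_or A (a *: x); last by rewrite scaler0.
exfalso; move/(LS_Z a^-1) : Ay; rewrite scalerBr scalerA mulVf// scale1r.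
exact: nA.
Qed.

Lemma LS_ext A B : graph A = graph B -> A = B.
Proof.
move=> AB; apply: val_inj; apply/funext => x; apply/funext => u.
exact: (congr1 (fun g => g (x, u)) AB).
Qed.

Lemma LS_maxE A B : graph A `<=` graph B -> A = B.
Proof. by move=> AB; apply/esym/LS_ext/(LS_maxmon A).2 => //; exact: (LS_maxmon B).1. Qed.

(* Each (x, u) in the graph of A has x = 0 or lies in the graph of B, and a
   vector space is not the union of two proper subspaces. *)
Lemma resolvent_inj_or A B : resolvent A =1 resolvent B ->
  graph A `<=` graph B \/ forall x u, A x u -> x = 0.
Proof.
move=> AB; have key x u : A x u -> x = 0 \/ B x u.
  move=> Axu; have Bx : resolvent B (x + u) = x by rewrite -AB resolvent_graph.
  have [By|[]] := resolvent_or B (x + u); last by rewrite Bx; left.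
  by rewrite Bx (addrC x) addrK in By; right.
have [|nAB] := pselect (graph A `<=` graph B); first by left.
right => x u Axu; apply: contrapT => x0.
apply: nAB => -[y v] /= Ayv; have [y0|//] := key _ _ Ayv.
have Bxu : B x u by case: (key _ _ Axu).
have [|Bs] := key _ _ (LS_D Axu Ayv); first by rewrite y0 addr0.
by rewrite /graph/=; have := LS_sub Bs Bxu; rewrite !(addrC x, addrC u) !addrK.
Qed.

Lemma LS_zero_dom A : (forall x u, A x u -> x = 0) -> forall u, A 0 u.
Proof.
move=> A0 u; pose Z : X -> set X := fun x => [set _ | x = 0].
have : graph Z = graph A.
  apply: (LS_maxmon A).2 => [x x' y y' -> ->|[x v] /= /A0//].
  by rewrite subrr dot0l.
move=> /(congr1 (fun g => g (0, u))) ZA; change (graph A (0, u)).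
by rewrite -ZA.
Qed.

Lemma resolvent_inj A B : resolvent A =1 resolvent B -> A = B.
Proof.
move=> AB; have [/LS_maxE//|A0] := resolvent_inj_or AB.
have [/LS_maxE//|B0] := resolvent_inj_or (fsym AB).
apply: LS_maxE => -[x u]; rewrite /graph/= => /A0 ->; exact: LS_zero_dom.
Qed.

Lemma resolvent_dist_eq0 A B : resolvent_dist A B = 0 -> A = B.
Proof.
move=> AB0; apply: resolvent_inj => x.
have [/enorm0_eq0->|x0] := eqVneq (enorm x) 0.
  by rewrite -(scale0r 0) !resolventZ !scale0r.
have -> : x = enorm x *: ((enorm x)^-1 *: x) by rewrite scalerA divff// scale1r.
rewrite !(resolventZ _ (enorm x)); congr (_ *: _).
apply/eqP; rewrite -subr_eq0; apply/eqP/enorm0_eq0/le_anti.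
rewrite enorm_ge0 andbT -AB0 resolvent_dist_ub// enormZ.
by rewrite ger0_norm ?invr_ge0 ?enorm_ge0// mulVf.
Qed.

Lemma pair_distxx p : pair_dist p p = 0.
Proof. by rewrite /pair_dist !resolvent_distxx addr0. Qed.

Lemma pair_dist_eq0 p q : pair_dist p q = 0 -> p = q.
Proof.
case: p q => [A1 B1] [A2 B2] /eqP; rewrite /pair_dist.
rewrite paddr_eq0 ?resolvent_dist_ge0//= => /andP[/eqP A0 /eqP B0].
by rewrite (resolvent_dist_eq0 A0) (resolvent_dist_eq0 B0).
Qed.

Lemma pair_dist_sym p q : pair_dist p q = pair_dist q p.
Proof. by rewrite /pair_dist !(resolvent_dist_sym (q.1)) !(resolvent_dist_sym (q.2)). Qed.

Lemma pair_dist_triangle q p r : pair_dist p r <= pair_dist p q + pair_dist q r.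
Proof. by rewrite /pair_dist addrACA lerD ?resolvent_dist_triangle. Qed.

HB.instance Definition _ := isMetric.Build R LS2
  pair_distxx pair_dist_eq0 pair_dist_sym pair_dist_triangle.

Lemma mdist_pairE (p q : LS2) : mdist p q =
  opnorm (fun x => resolvent p.1 x - resolvent q.1 x) +
  opnorm (fun x => resolvent p.2 x - resolvent q.2 x).
Proof. by []. Qed.

Definition DR_proximal_pairs : set LS2 :=
  [set AB : LS2 | proximal_mapping (Douglas_Rachford AB.1 AB.2)].

End PairMetric.
Arguments DR_proximal_pairs : clear implicits.

Definition nowhere_dense {T : topologicalType} (S : set T) : Prop :=
  interior (closure S) = set0.

(* Main.v *)
(* Write P, Q for the resolvents of A, B. Both are selfadjoint and firmly
   nonexpansive linear maps, and every such map is the resolvent of a symmetric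
   linear relation. The Douglas-Rachford operator is 1 + 2QP - P - Q. It is
   always linear and firmly nonexpansive, and a proximal mapping exactly when
   it is selfadjoint, that is, when PQ = QP: a closed condition. If all pairs
   near (P, Q) commuted, then so would P + t(E - P) and Q + t(F - Q) for small
   t > 0 with E and F any maps of the same kind, as well as the mixed pairs;
   subtracting these relations shows that E and F commute, which fails for two
   rank-one maps in dimension at least 2. *)

Require Import Defs.
From HB Require Import structures.
From mathcomp Require Import all_boot all_order all_algebra.
From mathcomp Require Import all_classical all_reals all_analysis.
From mathcomp Require Import ring lra.

Set Implicit Arguments.
Unset Strict Implicit.
Unset Printing Implicit Defensive.

Import Order.TTheory GRing.Theory Num.Theory.
Import numFieldNormedType.Exports.

Local Open Scope classical_set_scope.
Local Open Scope ring_scope.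

(** * Selfadjointness of linear resolvents of subdifferentials *)

Section SymmetricFirm.
Context {R : realType} {n : nat}.
Local Notation X := 'cV[R]_n.
Implicit Types (P Q T : X -> X) (f : X -> \bar R) (x y z w : X).

Definition selfadjoint P : Prop := forall x y, dot (P x) y = dot x (P y).

Lemma dot0r x : dot x 0 = 0.
Proof. by rewrite dotC dot0l. Qed.

Definition dotE := (@dotDl R n, @dotDr R n, @dotNl R n, @dotNr R n,
  @dotZl R n, @dotZr R n, @dot0l R n, dot0r).

Lemma linearB_fun P : linear P -> forall x y, P (x - y) = P x - P y.
Proof.
move=> lP x y; have := lP (-1) y x; rewrite !scaleN1r.
by rewrite (addrC x) (addrC (P x)).
Qed.

Lemma linear0_fun P : linear P -> P 0 = 0.
Proof. by move=> lP; have := linearB_fun lP 0 0; rewrite !subrr. Qed.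

Lemma linearZ_fun P : linear P -> forall a x, P (a *: x) = a *: P x.
Proof. by move=> lP a x; have := lP a x 0; rewrite !addr0 linear0_fun// addr0. Qed.

Lemma linearD_fun P : linear P -> forall x y, P (x + y) = P x + P y.
Proof. by move=> lP x y; have := lP 1 x y; rewrite !scale1r. Qed.

Lemma subdiff_fin_num f x u : proper_fun f -> subdiff f x u -> f x \is a fin_num.
Proof.
move=> [fN [y fy]] /(_ y) fxy; rewrite fin_numE fN/=.
by apply/eqP => fx; move: fxy fy; rewrite fx addey// leye_eq => /eqP ->.
Qed.

Lemma subdiff_monotone f : proper_fun f -> monotone_op (subdiff f).
Proof.
move=> pf x u y v xu yv.
have /fineK fx := subdiff_fin_num pf xu; have /fineK fy := subdiff_fin_num pf yv.
have := yv x; have := xu y; rewrite -fx -fy -!EFinD !lee_fin !dotE.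
lra.
Qed.

(* Adding inequalities for the two halves of a segment halves the constant of a
   quadratic bound. *)
Lemma midpoint_additive_eq0 (D : X -> X -> R) (q : X -> R) :
  (forall w z, D w z = D w (2^-1 *: (w + z)) + D (2^-1 *: (w + z)) z) ->
  (forall x, q (2^-1 *: x) = q x / 4) ->
  (forall w z, `|D w z| <= q (z - w)) -> forall w z, D w z = 0.
Proof.
move=> Dm qm Dq w z.
have key k : forall w z, `|D w z| <= 2^-1 ^+ k * q (z - w).
  elim: k => [|k IH] {}w {}z; first by rewrite expr0 mul1r.
  rewrite Dm (le_trans (ler_normD _ _))//.
  have h1 := IH w (2^-1 *: (w + z)); have h2 := IH (2^-1 *: (w + z)) z.
  have e1 : 2^-1 *: (w + z) - w = 2^-1 *: (z - w).
    by apply/colP => i; rewrite !mxE; field.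
  have e2 : z - 2^-1 *: (w + z) = 2^-1 *: (z - w).
    by apply/colP => i; rewrite !mxE; field.
  rewrite e1 qm in h1; rewrite e2 qm in h2; rewrite exprS.
  move: (2^-1 ^+ k) h1 h2 => c; lra.
apply/eqP; rewrite -normr_le0; apply/ler_addgt0Pr => e e0; rewrite add0r.
set c := q (z - w); have c0 : 0 <= c by rewrite (le_trans _ (Dq w z)).
(* Dividing by [c + 1] also covers [c = 0]. *)
have [N _ Nb] : \forall k \near \oo, (2^-1 : R) ^+ k < e / (c + 1).
  have : (fun k => (2^-1 : R) ^+ k) @ \oo --> (0 : R).
    by apply: cvg_expr; rewrite ger0_norm ?invr_ge0// invf_lt1// ltr1n.
  move/cvgrPdist_lt => /(_ (e / (c + 1))) h.
  have [//|N N1 Nb] := h _; first by rewrite divr_gt0//; lra.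
  exists N => // k kN; have := Nb k kN.
  by rewrite sub0r normrN ger0_norm// exprn_ge0.
have := Nb N (leqnn N); rewrite ltr_pdivlMr; last lra.
have := key N w z; rewrite -/c.
have : 0 <= (2^-1 : R) ^+ N by rewrite exprn_ge0.
nra.
Qed.

(** For selfadjoint [P] one expects [f (P x)] to be [<P x, x - P x> / 2] up to a constant.
    Increments of the remainder [phi] turn out to equal half the skew part of [P]. Measured from 0
    that part vanishes, so [phi] is constant, and then the skew part is zero everywhere. *)
Lemma subdiff_selfadjoint f P : proper_fun f -> linear P ->
  (forall x, subdiff f (P x) (x - P x)) -> selfadjoint P.
Proof.
move=> pf lP Pf.
pose g x := fine (f (P x)).
have gE x : f (P x) = (g x)%:E by rewrite fineK// (subdiff_fin_num pf (Pf x)).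
have gP x y : dot (P y - P x) (x - P x) + g x <= g y.
  by have := Pf x (P y); rewrite !gE -EFinD lee_fin.
pose q x := dot (P x) (x - P x).
pose phi x := g x - q x / 2.
(* [D w z] is [g z - g w] minus the average of its bounds from the subgradients at [w] and at [z];
   these two bounds differ by [q (z - w)]. *)
pose D w z := phi z - phi w - (dot (P z) w - dot (P w) z) / 2.
have D0 w z : D w z = 0.
  apply: (@midpoint_additive_eq0 D q) => {w z}.
  - move=> w z; rewrite /D !(linearZ_fun lP, linearD_fun lP) !dotE; lra.
  - by move=> x; rewrite /q (linearZ_fun lP) !dotE; field.
  - move=> w z; rewrite ler_norml /D /phi /q (linearB_fun lP).
    have := gP w z; have := gP z w; have := gP (z - w) 0; have := gP 0 (z - w).
    rewrite (linearB_fun lP) !(linear0_fun lP) !dotE.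
    rewrite (dotC (P z) (P w)).
    move=> *; apply/andP; split; lra.
have phiE z : phi z = phi 0.
  by have := D0 0 z; rewrite /D (linear0_fun lP) !dotE; lra.
move=> x y; have := D0 x y; rewrite /D (phiE x) (phiE y) (dotC x); lra.
Qed.

End SymmetricFirm.

(** * Selfadjoint firm linear maps as proximal mappings *)

Section Proximal.
Context {R : realType} {n : nat}.
Local Notation X := 'cV[R]_n.
Implicit Types (A : X -> set X) (P Q T : X -> X) (f h : X -> \bar R).
Implicit Types (x y z w u v : X).

(** For linear [P] this is firm nonexpansiveness, since differences reduce to a single vector. *)
Definition firm P : Prop := forall x, 0 <= dot (P x) (x - P x).

(** The default value is 0, so a nonzero value is a genuine solution. *)
Lemma resolvent_subdiff h x : resolvent (subdiff h) x != 0 ->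
  subdiff h (resolvent (subdiff h) x) (x - resolvent (subdiff h) x).
Proof.
rewrite /resolvent; case: xgetP => [y _ [u hu <-] _|_ /eqP//].
by rewrite (addrC y u) addrK.
Qed.

Lemma resolvent_monotone A x y : monotone_op A -> A y (x - y) ->
  resolvent A x = y.
Proof.
move=> mA Ay; rewrite /resolvent; case: xgetP => [z _ [u Au zu]|/(_ y)[]].
  have := mA _ _ _ _ Au Ay; rewrite -zu.
  have -> : u - (z + u - y) = - (z - y) by apply/colP => i; rewrite !mxE; ring.
  rewrite dotNr oppr_ge0 => zy; apply/eqP; rewrite -subr_eq0; apply/eqP.
  by apply: dotxx_eq0; apply/eqP; rewrite eq_le zy dotxx_ge0.
by exists (x - y) => //; rewrite addrC subrK.
Qed.

(* Where resolvent falls back to its default value 0, a nonzero T is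
   approximated along a line on which T vanishes only at that point. *)
Lemma proximal_subdiff h T : Gamma0 h -> T = resolvent (subdiff h) ->
  linear T -> (exists y, T y != 0) -> forall x, subdiff h (T x) (x - T x).
Proof.
move=> [_ lh ph] TE lT [y Ty] x.
have Th z : T z != 0 -> subdiff h (T z) (z - T z).
  by rewrite TE; exact: resolvent_subdiff.
have [Tx|] := eqVneq (T x) 0; last exact: Th.
rewrite Tx subr0 => z; rewrite subr0.
case hz : (h z) => [r| |]; last 2 first.
- by rewrite leey.
- by move: ph.1 => /(_ z); rewrite hz.
(* By lower semicontinuity, [a] bounds [h] from below near 0. Working with [a] instead of [h 0] also
   allows [h 0 = +oo] to be refuted at the end. *)
have key (a : R) : (a%:E < h 0%R)%E -> dot z x + a <= r.
  move=> /lh[V V0 Va].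
  have Vt : \forall t \near (0 : R)^'+, V (t *: T y).
    have : (t *: T y @[t --> (0 : R)^'+] --> (0 : X)).
      apply: cvg_at_right_filter; rewrite -(scale0r (T y)).
      by apply: cvgZr_tmp; exact: cvg_id.
    by apply.
  pose w := y - T y.
  pose c := dot z w - dot (T y) x.
  (* Left side of the subgradient inequality at [x + t *: y], with [a] in place of
     [h (t *: T y)]. *)
  pose g (t : R) := (dot z x + a) + (t * c - t * t * dot (T y) w).
  apply: (@cvgr_to_le _ (0 : R)^'+ _ _ g).
    have -> : dot z x + a = g 0 by rewrite /g; ring.
    apply: cvg_at_right_filter; apply: cvgD; first exact: cvg_cst.
    apply: cvgB; first by apply: cvgM; [exact: cvg_id|exact: cvg_cst].
    by apply: cvgM; [apply: cvgM; exact: cvg_id|exact: cvg_cst].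
  rewrite /g; near=> t.
  have t0 : 0 < t by near: t; exact: nbhs_right_gt.
  have Tt : T (x + t *: y) = t *: T y.
    by rewrite linearD_fun// linearZ_fun// Tx add0r.
  have := Th (x + t *: y); rewrite Tt scaler_eq0 negb_or gt_eqF// Ty => /(_ isT z).
  have /Va : V (t *: T y) by near: t.
  rewrite hz; case: (h (t *: T y)) => [b| |]//.
  rewrite lte_fin -EFinD lee_fin /c /w !dotE; lra.
case h0 : (h 0) key => [b| |] key; last by move: ph.1 => /(_ 0); rewrite h0.
  rewrite -EFinD lee_fin; apply/ler_addgt0Pr => e e0.
  have := key (b - e); rewrite lte_fin => /(_ _); lra.
by exfalso; have := key (r - dot z x + 1); rewrite ltry => /(_ isT); lra.
Unshelve. all: by end_near. Qed.

Lemma continuous_dot u : continuous (fun x => dot x u).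
Proof.
rewrite /dot; apply: continuous_big => [|i _ x]; first exact: add_continuous.
by apply: continuousM; [exact: coord_continuous|exact: cst_continuous].
Qed.

(* Half of <., T^-1 .> - |.|^2, written as a supremum of affine functions so
   that T need not be invertible. *)
Definition firm_potential T : X -> \bar R := fun z =>
  ereal_sup (range (fun x => (dot z (x - T x) - dot (T x) (x - T x) / 2)%:E)).

Lemma firm_potential_ge T z x :
  ((dot z (x - T x) - dot (T x) (x - T x) / 2)%:E <= firm_potential T z)%E.
Proof. by apply: ereal_sup_ubound; exists x. Qed.

Section Firm.
Variable T : X -> X.
Hypotheses (lT : linear T) (sT : selfadjoint T) (fT : firm T).

(** The supremum is attained at [x = y]: by selfadjointness any other term falls short by half of
    [<T (x - y), (x - y) - T (x - y)>], which is nonnegative. *)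
Lemma firm_potentialE y :
  firm_potential T (T y) = (dot (T y) (y - T y) / 2)%:E.
Proof.
apply/le_anti/andP; split; last first.
  by apply: le_trans (firm_potential_ge _ _ y); rewrite lee_fin; lra.
apply: ge_ereal_sup => _ [x _ <-]; rewrite lee_fin.
have := fT (x - y); rewrite (linearB_fun lT) !dotE (sT y x) (dotC y (T x)).
rewrite (dotC (T y) (T x)); lra.
Qed.

Lemma firm_potential_Gamma0 : Gamma0 (firm_potential T).
Proof.
split.
- move=> x y t /andP[t0 t1]; apply: ge_ereal_sup => _ [z _ <-].
  have hx := firm_potential_ge T x z; have hy := firm_potential_ge T y z.
  apply: le_trans (leeD (lee_wpmul2l _ hx) (lee_wpmul2l _ hy)).
  + by rewrite -!EFinM -EFinD lee_fin !dotE; lra.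
  + by rewrite lee_fin ltW.
  + by rewrite lee_fin subr_ge0 ltW.
- move=> x a /ereal_sup_gt[_ [z _ <-]]; rewrite lte_fin => az.
  exists [set y | a < dot y (z - T z) - dot (T z) (z - T z) / 2].
    have : {for x, continuous
        (fun y => dot y (z - T z) - dot (T z) (z - T z) / 2)}.
      by apply: continuousB; [exact: continuous_dot|exact: cst_continuous].
    by move/cvgr_gt => /(_ _ az).
  move=> y /= ay; apply: lt_le_trans (firm_potential_ge T y z).
  by rewrite lte_fin.
- split=> [x|].
    rewrite gt_eqF//; apply: lt_le_trans (firm_potential_ge T x 0).
    exact: ltNyr.
  by exists (T 0); rewrite firm_potentialE ltry.
Qed.

(** The affine function of index [y] is exact at [T y], so its slope is a subgradient there. *)
Lemma firm_potential_subdiff y : subdiff (firm_potential T) (T y) (y - T y).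
Proof.
move=> z; rewrite firm_potentialE; apply: le_trans (firm_potential_ge T z y).
by rewrite -EFinD lee_fin !dotE; lra.
Qed.

Lemma firm_potential_monotone : monotone_op (subdiff (firm_potential T)).
Proof. by apply: subdiff_monotone; case: firm_potential_Gamma0. Qed.

Lemma resolvent_firm_potential : resolvent (subdiff (firm_potential T)) = T.
Proof.
apply/funext => x; apply: resolvent_monotone (firm_potential_subdiff x).
exact: firm_potential_monotone.
Qed.

Lemma firm_proximal : proximal_mapping T.
Proof.
exists (firm_potential T); first exact: firm_potential_Gamma0.
by rewrite resolvent_firm_potential.
Qed.

Lemma firm_potential_subdiffE x u :
  subdiff (firm_potential T) x u <-> x = T (x + u).
Proof.
split=> [xu|xT]; last first.
  by have := firm_potential_subdiff (x + u); rewrite -xT (addrC x) addrK.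
rewrite -[in RHS]resolvent_firm_potential (@resolvent_monotone _ _ x)//.
  exact: firm_potential_monotone.
by rewrite addrC addKr.
Qed.

End Firm.

End Proximal.

(** * Resolvents of symmetric linear relations *)

Section SymmetricLinear.
Context {R : realType} {n : nat}.
Local Notation X := 'cV[R]_n.
Local Notation LS := (symmetric_linear R n).
Implicit Types (A B : LS) (P Q E F : X -> X) (x y z w u v : X).

(** A matrix of maximal rank with row space inside [V] spans [V], since a missing vector could be
    added. A column of its cokernel then annihilates [V] but not [x]. *)
Lemma subspace_orthogonal (V : set X) x : V 0 ->
  (forall a y z, V y -> V z -> V (a *: y + z)) -> ~ V x ->
  exists2 w, dot x w != 0 & forall v, V v -> dot v w = 0.
Proof.
move=> V0 Vlin Vx.
pose good k := exists M : 'M[R]_n,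
  \rank M = k /\ forall r : 'rV_n, (r <= M)%MS -> V r^T.
have [k0 gk0] : exists k, `[< good k >].
  exists 0%N; apply/asboolP; exists 0; rewrite mxrank0; split=> // r.
  by rewrite submx0 => /eqP ->; rewrite trmx0.
have gb k : `[< good k >] -> (k <= n)%N.
  by move=> /asboolP[M [<- _]]; exact: rank_leq_col.
have [k /asboolP[M [rM MV]] kmax] := ex_maxnP (ex_intro _ k0 gk0) gb.
have VM v : V v -> (v^T <= M)%MS.
  move=> Vv; apply: contraT => vM.
  have : `[< good (\rank (M + v^T)%MS) >].
    apply/asboolP; exists (M + v^T)%MS; split=> // r /sub_addsmxP[[a b] /= ->].
    rewrite linearD/= addrC (mx11_scalar b) mul_scalar_mx linearZ/= trmxK.
    by apply: Vlin => //; apply: MV; exact: submxMl.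
  move=> /kmax; rewrite -rM leqNgt => /negP[].
  have : (M < M + v^T)%MS by rewrite /ltmx addsmxSl addsmx_sub submx_refl.
  by rewrite ltmxErank => /andP[].
have : ~~ (x^T <= M)%MS.
  by apply/negP => /MV; rewrite trmxK.
rewrite submxE => /rV0Pn[j xj].
have dotM v : dot v (col j (cokermx M)) = (v^T *m cokermx M) 0 j.
  by rewrite !mxE; apply: eq_bigr => i _; rewrite !mxE.
exists (col j (cokermx M)); first by rewrite dotM.
by move=> v /VM; rewrite dotM submxE => /eqP ->; rewrite mxE.
Qed.

(* A vector w orthogonal to the range of Id + A makes (w, w) monotonically
   related to A, hence w = 0 by maximality. *)
Lemma resolvent_spec A x : A (resolvent A x) (x - resolvent A x).
Proof.
have [//|[_ nA]] := resolvent_or A x.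
pose V : set X := [set y | exists z, A z (y - z)].
have [||| w xw wV] := @subspace_orthogonal V x.
- by exists 0; rewrite subrr; exact: LS_0.
- move=> a y z [y' Ay] [z' Az]; exists (a *: y' + z').
  have -> : a *: y + z - (a *: y' + z') = a *: (y - y') + (z - z').
    by apply/colP => i; rewrite !mxE; ring.
  exact: LS_lin.
- by move=> [y /nA].
pose Aw : X -> set X := fun y => [set v | A y v \/ y = w /\ v = w].
have Aww : A w w.
  have AwE : graph Aw = graph A.
    apply: (LS_maxmon A).2; last by move=> [y v] Ayv; left.
    (* The cross terms [- <y + v, w>] vanish because [y + v] lies in [V]; what remains is
       [<y, v> + |w|^2]. *)
    have mon y v : A y v -> 0 <= dot (y - w) (v - w).
      move=> Ayv; have := (LS_maxmon A).1 _ _ _ _ Ayv (LS_0 A).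
      have := wV (y + v); rewrite !subr0 !dotE (dotC w v) => /(_ _)yv.
      have {}yv : dot y w + dot v w = 0.
        by apply: yv; exists y; rewrite addrC addKr.
      have := dotxx_ge0 w; lra.
    move=> y v z t [Ay|[-> ->]] [Az|[-> ->]].
    - exact: (LS_maxmon A).1 Ay Az.
    - exact: mon.
    - by rewrite -opprB -(opprB t) dotNl dotNr opprK; exact: mon.
    - by rewrite subrr dot0l.
  have : graph Aw (w, w) by right.
  by rewrite AwE.
(* [Aww] puts [w + w] in [V], to which [w] is orthogonal. *)
have w0 : w = 0.
  apply: dotxx_eq0; have := wV (w + w); rewrite dotDl => ww.
  have : dot w w + dot w w = 0 by apply: ww; exists w; rewrite addrK.
  by lra.
by move: xw; rewrite w0 dot0r eqxx.
Qed.

Lemma resolvent_linear A : linear (resolvent A).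
Proof.
move=> a x y; have := LS_lin a (resolvent_spec A x) (resolvent_spec A y).
move=> /resolvent_graph <-; congr resolvent.
by apply/colP => i; rewrite !mxE; ring.
Qed.

Lemma resolvent_firm A : firm (resolvent A).
Proof.
move=> x; have := (LS_maxmon A).1 _ _ _ _ (resolvent_spec A x) (LS_0 A).
by rewrite !subr0.
Qed.

Lemma resolvent_selfadjoint A : selfadjoint (resolvent A).
Proof.
have /set_mem[_ [f [_ _ pf] fA]] := valP A.
apply: (subdiff_selfadjoint pf (resolvent_linear A)) => x.
by rewrite fA; exact: resolvent_spec.
Qed.

Lemma exists_resolvent P : linear P -> selfadjoint P -> firm P ->
  exists A : LS, resolvent A = P.
Proof.
move=> lP sP fP; pose S : X -> set X := subdiff (firm_potential P).
have SP x u : S x u <-> x = P (x + u) by exact: firm_potential_subdiffE.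
have mS : monotone_op S by exact: firm_potential_monotone.
suff LS_S : (max_monotone_linear R n `&` subdifferentials R n) S.
  exists (exist _ S (mem_set LS_S)); exact: resolvent_firm_potential.
split; last by exists (firm_potential P) => //; exact: firm_potential_Gamma0.
split; split=> //.
(* Maximality: [Id + S] is onto, so [(x, u)] shares its sum [x + u] with a point of [S], and
   monotonicity of [B] makes the two points coincide. *)
- move=> B mB SB; apply/seteqP; split=> // -[x u] /= Bxu; apply/SP.
  have Pxu : S (P (x + u)) (x + u - P (x + u)) by exact: firm_potential_subdiff.
  have /= <- := resolvent_monotone mB (SB (_, _) Pxu).
  by rewrite (@resolvent_monotone _ _ B _ x)// addrC addKr.
- by rewrite inE; apply/SP; rewrite addr0 linear0_fun.
- move=> a [x u] [y v]; rewrite !inE => /SP/= xu /SP/= yv; apply/SP => /=.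
  rewrite {1}xu {1}yv -lP; congr P.
  by apply/colP => i; rewrite !mxE; ring.
Qed.

End SymmetricLinear.

(** * Proximal Douglas-Rachford operators and closedness *)

Section DouglasRachford.
Context {R : realType} {n : nat}.
Local Notation X := 'cV[R]_n.
Local Notation LS := (symmetric_linear R n).
Implicit Types (A B : LS) (P Q E F T : X -> X) (x y z w u v : X).

Lemma dot_inj x y : (forall z, dot x z = dot y z) -> x = y.
Proof.
move=> xy; apply/eqP; rewrite -subr_eq0; apply/eqP/dotxx_eq0.
by rewrite dotDl dotNl xy subrr.
Qed.

Definition commuting P Q : Prop := forall x, P (Q x) = Q (P x).

Lemma Douglas_RachfordE A B x : Douglas_Rachford A B x =
  x + 2 *: resolvent B (resolvent A x) - resolvent A x - resolvent B x.
Proof.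
rewrite /Douglas_Rachford /reflected_resolvent.
rewrite (linearB_fun (resolvent_linear B)) (linearZ_fun (resolvent_linear B)).
by apply/colP => i; rewrite !mxE; field.
Qed.

Lemma Douglas_Rachford_linear A B : linear (Douglas_Rachford A B).
Proof.
move=> a x y; rewrite !Douglas_RachfordE !resolvent_linear.
by apply/colP => i; rewrite !mxE; ring.
Qed.

(** With [a], [r], [b] as below, [<T x, x - T x>] is exactly [<a, x - a> + <b, r - b>]. *)
Lemma Douglas_Rachford_firm A B : firm (Douglas_Rachford A B).
Proof.
move=> x; rewrite /Douglas_Rachford /reflected_resolvent.
set a := resolvent A x; set r := 2 *: a - x.
have := resolvent_firm A x; have := resolvent_firm B r.
rewrite -/a; set b := resolvent B r.
have -> : 2^-1 *: (x + (2 *: b - r)) = x - a + b.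
  by apply/colP => i; rewrite !mxE; field.
rewrite /r !dotE (dotC b x) (dotC b a) (dotC a x); lra.
Qed.

Lemma Douglas_Rachford_selfadjoint A B :
  selfadjoint (Douglas_Rachford A B) <->
  commuting (resolvent A) (resolvent B).
Proof.
have PQ x y : dot x (resolvent B (resolvent A y)) =
    dot (resolvent A (resolvent B x)) y.
  by rewrite (resolvent_selfadjoint A) (resolvent_selfadjoint B).
split=> [sT x|AB x y].
  apply: dot_inj => y; have := sT x y; rewrite !Douglas_RachfordE !dotE PQ.
  by rewrite (resolvent_selfadjoint A x) (resolvent_selfadjoint B x); lra.
rewrite !Douglas_RachfordE !dotE PQ AB.
by rewrite (resolvent_selfadjoint A x) (resolvent_selfadjoint B x); lra.
Qed.

Lemma Douglas_Rachford_proximal A B :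
  proximal_mapping (Douglas_Rachford A B) <->
  commuting (resolvent A) (resolvent B).
Proof.
rewrite -Douglas_Rachford_selfadjoint; split=> [[h Gh Th]|sT].
  have lT := Douglas_Rachford_linear A B.
  (* The zero operator is selfadjoint outright; it is split off because [proximal_subdiff] needs a
     nonzero value. *)
  have [T0|nT0] := pselect (exists x, Douglas_Rachford A B x != 0).
    have [_ _ ph] := Gh.
    exact: subdiff_selfadjoint ph lT (proximal_subdiff Gh Th lT T0).
  have T0 x : Douglas_Rachford A B x = 0.
    by apply/eqP/negPn/negP => Tx; apply: nT0; exists x.
  by move=> x y; rewrite !T0 dot0l dot0r.
apply: firm_proximal => //; first exact: Douglas_Rachford_linear.
exact: Douglas_Rachford_firm.
Qed.

Lemma enorm_ball_eq0 P : linear P ->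
  (forall x, enorm x <= 1 -> P x = 0) -> forall x, P x = 0.
Proof.
move=> lP P0 x; have [/enorm0_eq0->|x0] := eqVneq (enorm x) 0.
  exact: linear0_fun.
have -> : x = enorm x *: ((enorm x)^-1 *: x) by rewrite scalerA divff// scale1r.
rewrite (linearZ_fun lP) P0 ?scaler0// enormZ.
by rewrite ger0_norm ?invr_ge0 ?enorm_ge0// mulVf.
Qed.

Lemma resolvent_comp_dist A B A' B' x : enorm x <= 1 ->
  enorm (resolvent B (resolvent A x) - resolvent B' (resolvent A' x)) <=
  resolvent_dist A A' + resolvent_dist B B'.
Proof.
move=> x1; set a := resolvent A x; set a' := resolvent A' x.
have -> : resolvent B a - resolvent B' a' =
    resolvent B (a - a') + (resolvent B a' - resolvent B' a').
  by rewrite (linearB_fun (resolvent_linear B)) subrKA.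
apply: le_trans (enormD _ _) _; apply: lerD.
  by apply: le_trans (enorm_resolvent _ _) _; exact: resolvent_dist_ub.
by apply: resolvent_dist_ub; apply: le_trans (enorm_resolvent _ _) x1.
Qed.

Lemma closed_DR_proximal_pairs : closed (DR_proximal_pairs R n).
Proof.
move=> [A B] clAB; apply/Douglas_Rachford_proximal => x; apply/eqP.
rewrite -subr_eq0; apply/eqP; move: x; apply: enorm_ball_eq0.
  move=> a x y; rewrite !resolvent_linear.
  by apply/colP => i; rewrite !mxE; ring.
move=> x x1; apply/enorm0_eq0/le_anti; rewrite enorm_ge0 andbT.
apply/ler_addgt0Pr => e e0; rewrite add0r.
(* The commutator contains two compositions, each moving by at most the distance between the
   pairs. *)
have e20 : 0 < e / 2 by rewrite divr_gt0.
have [[A' B'] [/= /Douglas_Rachford_proximal AB']] :=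
  clAB _ (nbhsx_ballx _ _ e20).
rewrite ballEmdist/= mdist_pairE -![opnorm _]/(resolvent_dist _ _) => d.
have h1 := resolvent_comp_dist A B A' B' x1.
have h2 := resolvent_comp_dist B A B' A' x1.
have -> : resolvent A (resolvent B x) - resolvent B (resolvent A x) =
   (resolvent A (resolvent B x) - resolvent A' (resolvent B' x)) -
   (resolvent B (resolvent A x) - resolvent B' (resolvent A' x)).
  by rewrite AB'; apply/colP => i; rewrite !mxE; ring.
apply: le_trans (enormD _ _) _; rewrite enormN; move: d h1 h2; lra.
Qed.

(** * Perturbation towards rank-one maps *)

Definition interpolate (t : R) P E : X -> X :=
  fun x => (1 - t) *: P x + t *: E x.

Lemma interpolate_linear t P E : linear P -> linear E ->
  linear (interpolate t P E).
Proof.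
move=> lP lE a x y; rewrite /interpolate lP lE.
by apply/colP => i; rewrite !mxE; ring.
Qed.

Lemma interpolate_selfadjoint t P E : selfadjoint P -> selfadjoint E ->
  selfadjoint (interpolate t P E).
Proof. by move=> sP sE x y; rewrite /interpolate !dotE sP sE. Qed.

(** [<a, x - a>] is concave in [a], with surplus [t (1 - t) |a - b|^2]. *)
Lemma interpolate_firm t P E : 0 <= t <= 1 -> firm P -> firm E ->
  firm (interpolate t P E).
Proof.
move=> /andP[t0 t1] fP fE x; rewrite /interpolate.
have := fP x; have := fE x; set a := P x; set b := E x => bx ax.
have -> : dot ((1 - t) *: a + t *: b) (x - ((1 - t) *: a + t *: b)) =
    (1 - t) * dot a (x - a) + t * dot b (x - b) +
    t * (1 - t) * dot (a - b) (a - b).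
  by rewrite !dotE (dotC b a); ring.
by rewrite !addr_ge0// !mulr_ge0 ?subr_ge0// dotxx_ge0.
Qed.

Definition rank1 v : X -> X := fun x => dot x v *: v.

Lemma rank1_linear v : linear (rank1 v).
Proof.
by move=> a x y; rewrite /rank1 !dotE scalerDl scalerA.
Qed.

Lemma rank1_selfadjoint v : selfadjoint (rank1 v).
Proof. by move=> x y; rewrite /rank1 !dotE (dotC v y) mulrC. Qed.

Lemma rank1_firm v : dot v v <= 1 -> firm (rank1 v).
Proof.
move=> v1 x; rewrite /rank1 !dotE (dotC v x).
have := sqr_ge0 (dot x v); nra.
Qed.

Lemma firm_enorm P x : firm P -> enorm (P x) <= enorm x.
Proof.
move=> /(_ x); rewrite dotDr dotNr subr_ge0 -enorm_sqr => Px.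
have [->|Px0] := eqVneq (enorm (P x)) 0; first exact: enorm_ge0.
have {}Px0 : 0 < enorm (P x) by rewrite lt_neqAle eq_sym Px0 enorm_ge0.
by rewrite -(ler_pM2l Px0) -expr2 (le_trans Px)// cauchy_schwarz.
Qed.

Lemma exists_interpolate (t : R) A v : 0 <= t <= 1 -> dot v v <= 1 ->
  exists2 A' : LS, resolvent A' = interpolate t (resolvent A) (rank1 v) &
    resolvent_dist A A' <= 2 * t.
Proof.
move=> t01 v1; have /andP[t0 t1] := t01.
have [A' A'E] := @exists_resolvent R n (interpolate t (resolvent A) (rank1 v))
  (interpolate_linear _ (resolvent_linear A) (rank1_linear v))
  (interpolate_selfadjoint _ (resolvent_selfadjoint A) (rank1_selfadjoint v))
  (interpolate_firm t01 (resolvent_firm A) (rank1_firm v1)).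
exists A' => //; apply: resolvent_dist_le => x x1; rewrite A'E /interpolate.
have -> : resolvent A x - ((1 - t) *: resolvent A x + t *: rank1 v x) =
    t *: (resolvent A x + - rank1 v x).
  by apply/colP => i; rewrite !mxE; ring.
rewrite enormZ ger0_norm// mulrC ler_wpM2r// (le_trans (enormD _ _))// enormN.
have := firm_enorm x (resolvent_firm A).
have := firm_enorm x (rank1_firm v1); lra.
Qed.

Lemma commuting_sym P Q : commuting P Q -> commuting Q P.
Proof. by move=> PQ x; rewrite PQ. Qed.

Lemma interpolate_commuting (t : R) P E Q : t != 0 -> linear Q ->
  commuting P Q -> commuting (interpolate t P E) Q -> commuting E Q.
Proof.
move=> t0 lQ PQ + x => /(_ x); rewrite /interpolate.
rewrite (linearD_fun lQ) !(linearZ_fun lQ) PQ => /addrI; exact: scalerI.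
Qed.

Lemma dot_delta i x : dot (delta_mx i 0) x = x i 0.
Proof.
rewrite /dot (bigD1 i)//= big1 => [|j /negPf ji]; last by rewrite mxE ji mul0r.
by rewrite mxE !eqxx mul1r addr0.
Qed.

(** At [x], one composition gives 0 and the other a nonzero multiple of [v]. *)
Lemma rank1_not_commuting v w x : dot x v = 0 -> dot x w != 0 ->
  dot v w != 0 -> v != 0 -> ~ commuting (rank1 v) (rank1 w).
Proof.
move=> xv xw vw v0 /(_ x)/eqP; rewrite /rank1 xv !dotE mul0r scale0r.
by rewrite scaler_eq0 mulf_eq0 (dotC w v) (negPf xw) (negPf vw) (negPf v0).
Qed.

End DouglasRachford.

Theorem theorem3p1 (R : realType) (n : nat) (hn : (2 <= n)%N) :
  closed (DR_proximal_pairs R n) /\ nowhere_dense (DR_proximal_pairs R n).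
Proof.
split; first exact: closed_DR_proximal_pairs.
rewrite /nowhere_dense -(closure_id _).1; last exact: closed_DR_proximal_pairs.
apply/seteqP; split=> // -[A B] /nbhs_ballP[e /= e0 ABe].
pose i0 : 'I_n := Ordinal (ltnW hn); pose i1 : 'I_n := Ordinal hn.
pose v : 'cV[R]_n := delta_mx i0 0.
(* Neither parallel nor orthogonal to [v]; the factor 1/2 keeps [|w| <= 1], so that [rank1 w] is
   firm. *)
pose w : 'cV[R]_n := 2^-1 *: (v + delta_mx i1 0).
have vv : dot v v = 1 by rewrite dot_delta mxE !eqxx.
have vw : dot v w = 2^-1 by rewrite dot_delta !mxE !eqxx /= addr0 mulr1.
have xv : dot (delta_mx i1 0) v = 0 by rewrite dot_delta mxE.
have xw : dot (delta_mx i1 0) w = 2^-1.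
  by rewrite dot_delta !mxE !eqxx /= add0r mulr1.
have ww : dot w w <= 1.
  by rewrite {1}/w dotZl dotDl vw xw; lra.
(* This gives [t < 1], and [4 t < e]: moving both components by at most [2 t] stays in the ball. *)
pose t := e / (e + 8).
have e8 : 0 < e + 8 by lra.
have t0 : 0 < t by rewrite divr_gt0.
have te : t * (e + 8) = e by rewrite divfK// gt_eqF.
have t01 : 0 <= t <= 1 by rewrite ltW//=; nra.
have [A' A'E dA] : exists2 A' : symmetric_linear R n,
    resolvent A' = interpolate t (resolvent A) (rank1 v) &
    resolvent_dist A A' <= 2 * t by apply: exists_interpolate; rewrite ?vv.
have [B' B'E dB] : exists2 B' : symmetric_linear R n,
    resolvent B' = interpolate t (resolvent B) (rank1 w) &
    resolvent_dist B B' <= 2 * t by exact: exists_interpolate.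
have near_commuting (C D : symmetric_linear R n) :
    resolvent_dist A C <= 2 * t -> resolvent_dist B D <= 2 * t ->
    commuting (resolvent C) (resolvent D).
  move=> AC BD; apply/Douglas_Rachford_proximal.
  apply: (ABe (C, D)); rewrite ballEmdist/= mdist_pairE.
  rewrite -![opnorm _]/(resolvent_dist _ _) /=; move: AC BD; nra.
have AA : resolvent_dist A A <= 2 * t by rewrite resolvent_distxx; lra.
have BB : resolvent_dist B B <= 2 * t by rewrite resolvent_distxx; lra.
have t_neq0 : t != 0 by rewrite gt_eqF.
have half_neq0 : (2^-1 : R) != 0 by rewrite invr_eq0 pnatr_eq0.
(* Comparing [(A, B)] with [(A', B)] cancels [resolvent A]; [EQ'] does the same over [B']. *)
have EQ : commuting (rank1 v) (resolvent B).
  apply: (interpolate_commuting t_neq0 (resolvent_linear B)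
    (near_commuting _ _ AA BB)).
  by rewrite -A'E; exact: near_commuting.
have EQ' : commuting (rank1 v) (resolvent B').
  apply: (interpolate_commuting t_neq0 (resolvent_linear B')
    (near_commuting _ _ AA dB)).
  by rewrite -A'E; exact: near_commuting.
apply: (@rank1_not_commuting _ _ v w (delta_mx i1 0)); rewrite ?xw ?vw//.
  by apply/eqP => v0; move: vv; rewrite v0 dot0l => /eqP; rewrite eq_sym oner_eq0.
(* Comparing [EQ] with [EQ'] cancels [resolvent B], leaving the two rank-one maps. *)
apply/commuting_sym/(interpolate_commuting t_neq0 (rank1_linear v)
  (commuting_sym EQ)).
by rewrite -B'E; exact: commuting_sym.
Qed.
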